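(* Let $k,N\ge 1$ be integers and let $X_1,\dots,X_k$ be pairwise disjoint finite nonempty sets with $|X_i|=n_i$. Let $\mathrm{EC}(N)$ be the set of eventually $N$-cyclic $k$-tuples $f=(f_1,\dots,f_k)$ of functions $f_i:X_i\to X_{i+1}$ (indices modulo $k$), and let $P_N(\mathbf x)=\sum_{f\in\mathrm{EC}(N)}w(f)$. Then $$P_N(\mathbf x)=\frac{(N!)^k}{N}\prod_{i=1}^k e_1(X_i)^{n_{i-1}-(N+1)}\left(\prod_{j=1}^k e_N(X_j)e_1(X_j)-(N+1)^k\prod_{j=1}^k e_{N+1}(X_j)\right).$$
   Context: Indices are modulo $k$, so $X_{k+1}=X_1$ and $n_0=n_k$. A $k$-tuple $(f_1,\dots,f_k)$ with $f_i:X_i\to X_{i+1}$ is eventually $N$-cyclic if the iterated images $(f_k\cdots f_1)^m(X_1)$ of the composition $f_k\cdots f_1:X_1\to X_1$ eventually stabilize (for large $m$) to a subset of $X_1$ of cardinality $N$ on which $f_k\cdots f_1$ acts as an $N$-cycle (a single cyclic permutation of all $N$ elements). There is one commuting variable $x_v$ for each $v\in X=\bigsqcup_i X_i$. The weight of a $k$-tuple is $w(f)=\prod_{i=1}^k\prod_{v\in X_i}x_{f_i(v)}$. For a vertex set $U$, $e_j(U)=\sum_{S\subseteq U,\,|S|=j}\prod_{v\in S}x_v$ (so $e_j(U)=0$ if $j>|U|$). Where an exponent is negative, the identity is read in the field of rational functions in the $x_v$. *)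

(* Defs.v *)
From HB Require Import structures.
From mathcomp Require Import all_boot all_order all_algebra.
From mathcomp Require Import boolp.
From mathcomp Require Import mpoly.

Set Implicit Arguments.
Unset Strict Implicit.
Unset Printing Implicit Defensive.

Import GRing.Theory.
Local Open Scope ring_scope.

Notation "p %:F" := (FracField.tofrac p) : ring_scope.

(* The pairwise disjoint finite sets X_1, ..., X_k are a family of finite types
   indexed by 'I_k (so X_1 is the type at index 0), and their disjoint union is
   the sigma type [vertex X]. Indices are cyclic: i + 1 is [ordS i] and i - 1
   is [ord_pred i]. *)
Definition vertex (k : nat) (X : 'I_k -> finType) : finType := {i : 'I_k & X i}.

Definition layer (k : nat) (X : 'I_k -> finType) (i : 'I_k) : {set vertex X} :=
  [set v : vertex X | tag v == i].

Definition fun_tuple (k : nat) (X : 'I_k -> finType) : finType :=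
  {dffun forall i : 'I_k, {ffun X i -> X (ordS i)}}.

Section Cyclicity.
Variables (k : nat) (X : 'I_k -> finType).
Implicit Types f : fun_tuple X.

(* All the f_i together, as one self-map of the disjoint union. *)
Definition step f (v : vertex X) : vertex X :=
  Tagged (fun i => X i) (f (tag v) (tagged v)).

(* On X_1 this is the composition f_k ... f_1 : X_1 -> X_1. *)
Definition round f : vertex X -> vertex X := iter k (step f).

Definition acts_as_cycle (T : finType) (g : T -> T) (A : {set T}) : Prop :=
  exists s : seq T, ufcycle g s /\ A = [set:: s].

(* [i1] is the index of X_1. *)
Definition eventually_cyclic (i1 : 'I_k) (N : nat) f : Prop :=
  exists A : {set vertex X},
    [/\ exists M : nat, forall m : nat, (M <= m)%N ->
          [set iter m (round f) v | v in layer X i1] = A,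
        A \subset layer X i1,
        #|A| = N
      & acts_as_cycle (round f) A].

Definition EC (i1 : 'I_k) (N : nat) : {set fun_tuple X} :=
  [set f | `[< eventually_cyclic i1 N f >]].

End Cyclicity.

Section Weights.
Variables (k : nat) (X : 'I_k -> finType).

Definition poly_ring : idomainType := {mpoly rat[#|vertex X|]}.

Definition xvar (v : vertex X) : poly_ring := 'X_(enum_rank v).

Definition weight (f : fun_tuple X) : poly_ring :=
  \prod_(i < k) \prod_(v : X i) xvar (Tagged (fun i => X i) (f i v)).

Definition elem_sym (j : nat) (U : {set vertex X}) : poly_ring :=
  \sum_(S : {set vertex X} | (S \subset U) && (#|S| == j))
    \prod_(v in S) xvar v.

Definition P_ (i1 : 'I_k) (N : nat) : poly_ring :=
  \sum_(f in EC X i1 N) weight f.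

End Weights.

(* Main.v *)
Require Import Defs.
From mathcomp Require Import all_boot all_order all_algebra.
From mathcomp Require Import perm boolp.
From mathcomp Require Import mpoly.

Set Implicit Arguments.
Unset Strict Implicit.
Unset Printing Implicit Defensive.

Import GRing.Theory.
Local Open Scope ring_scope.

(* Write V for the union of the X_i, E_j = e_1(X_j), and view a tuple as a
   self-map g of V. Each g in EC(N) has exactly N labellings s(j, a) of its
   periodic points (a < N, s(j, a) in X_j) in which g runs through the points
   in the order j + a k, one for each choice of the starting point in X_1.
   So N P_N is a sum over s of the weights of the g which follow s on its
   support C and whose orbits all reach C. For fixed s, expanding a determinant
   by multilinearity in its rows (the matrix-tree argument) evaluates this sum
   as det (D (1 - A B)), with A B of rank at most k because transitions only
   depend on layers; det (1 - A B) = det (1 - B A) leaves a k x k cyclic matrix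
   whose determinant is 1 - prod_j e_1(X_j \ C) / E_j. Summing over s factors
   over the layers: sum_S x^S = e_N and
   sum_S x^S e_1(X_j \ S) = (N + 1) e_(N + 1), each counted N! times. *)

(** * A matrix-forest formula *)

Lemma big_enum_valT (R : Type) (idx : R) (op : Monoid.com_law idx) (T : finType)
    (F : T -> R) :
  \big[op/idx]_(i < #|T|) F (enum_val i) = \big[op/idx]_u F u.
Proof.
rewrite [RHS](reindex_onto enum_val enum_rank) /=; last first.
  by move=> j _; rewrite enum_rankK.
by apply: eq_bigl => j; rewrite enum_valK eqxx.
Qed.

(** The matrix with blocks [1, A, B, 1] times the one with blocks [1, 0, - B, 1] is block triangular
    in either order. The diagonal blocks are [1 - A B] and [1] in one order, [1] and [1 - B A] in
    the other. *)
Lemma det_sub1_mulC (K : comNzRingType) (m n : nat)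
    (A : 'M[K]_(m, n)) (B : 'M[K]_(n, m)) :
  \det (1%:M - A *m B) = \det (1%:M - B *m A).
Proof.
have E1 : block_mx 1%:M A B 1%:M *m block_mx 1%:M 0 (- B) 1%:M
        = block_mx (1%:M - A *m B) A 0 1%:M.
  by rewrite mulmx_block !mulmx1 !mul1mx !mulmx0 !mulmxN !add0r subrr.
have E2 : block_mx 1%:M 0 (- B) 1%:M *m block_mx 1%:M A B 1%:M
        = block_mx 1%:M A 0 (1%:M - B *m A).
  by rewrite mulmx_block !mulmx1 !mul1mx !mul0mx !mulNmx !addr0 addNr addrC.
have := congr1 determinant E1; have := congr1 determinant E2.
rewrite !det_mulmx !det_ublock !det1 mul1r mulr1 => <- <-.
by rewrite mulrC.
Qed.

(* A partial self-map, [None] standing for undefined, all of whose orbits end. *)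
Definition mortal (T : finType) (f : T -> option T) : Prop :=
  forall u, exists m, iter m (obind f) (Some u) = None.

Lemma iter_obindS (T : finType) (f : T -> option T) m u :
  iter m.+1 (obind f) (Some u) = iter m (obind f) (f u).
Proof. by rewrite iterSr. Qed.

(* If [f] is mortal, only the identity contributes to the Leibniz formula: a
   contributing permutation agrees with [f] on the points it moves, and it moves
   them forever. Otherwise the indicator of the immortal points is in the
   kernel. *)
Lemma det_mortal (K : fieldType) (T : finType) (f : T -> option T) :
  \det (\matrix_(i < #|T|, j < #|T|)
     ((enum_val i == enum_val j)%:R - (f (enum_val i) == Some (enum_val j))%:R))
  = `[< mortal f >]%:R :> K.
Proof.
case: asboolP => [fm | fnm].
- rewrite /determinant (bigD1 (1%g : 'S_#|T|)) //= odd_perm1 expr0 mul1r.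
  rewrite [X in _ + X]big1 ?addr0 => [|s s1].
    rewrite big1 // => i _; rewrite mxE perm1 eqxx.
    case: eqP => [fi|]; last by rewrite subr0.
    have [m] := fm (enum_val i).
    by elim: m => // m IH; rewrite iter_obindS fi.
  have [i si] : exists i, s i != i.
    apply/existsP; apply: contraNT s1; rewrite negb_exists => /forallP s1.
    by apply/eqP/permP => i; rewrite perm1; apply/eqP; rewrite -[_ == _]negbK.
  have [/existsP[j /andP[sj fj]]|/existsPn nf] :=
    boolP [exists j, (s j != j) && (f (enum_val j) != Some (enum_val (s j)))].
    rewrite (bigD1 j) //= mxE (negPf fj) subr0 (inj_eq enum_val_inj) eq_sym.
    by rewrite (negPf sj) mul0r mulr0.
  have fE j : s j != j -> f (enum_val j) = Some (enum_val (s j)).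
    by move=> sj; have := nf j; rewrite sj negbK => /eqP.
  have [m] := fm (enum_val i); elim: m i si => // m IH i si.
  by rewrite iter_obindS fE //; apply: IH; rewrite (inj_eq perm_inj).
- rewrite -det_tr; apply/eqP/det0P.
  pose dead u := exists m, iter m (obind f) (Some u) = None.
  exists (\row_i (~~ `[< dead (enum_val i) >])%:R).
    move/existsNP: fnm => [u nu]; apply/eqP => /rowP/(_ (enum_rank u))/eqP.
    by rewrite !mxE enum_rankK; case: asboolP => //= _; rewrite oner_eq0.
  apply/rowP => i; rewrite !mxE.
  pose c u : K := (~~ `[< dead u >])%:R.
  transitivity (\sum_u c u * ((enum_val i == u)%:R - (f (enum_val i) == Some u)%:R)).
    by rewrite -[RHS]big_enum_valT; apply: eq_bigr => j _; rewrite !mxE.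
  under eq_bigr do rewrite mulrBr.
  rewrite sumrB (bigD1 (enum_val i)) //= eqxx mulr1 big1 ?addr0; last first.
    by move=> j /negPf; rewrite eq_sym => ->; rewrite mulr0.
  case fi : (f (enum_val i)) => [w|].
    rewrite (bigD1 w) //= eqxx mulr1 big1 ?addr0; last first.
      by move=> j /negPf jw; rewrite (inj_eq Some_inj) eq_sym jw mulr0.
    rewrite /c; suff -> : `[< dead (enum_val i) >] = `[< dead w >] by rewrite subrr.
    apply: asbool_equiv_eq; split=> -[m].
      by case: m => // m; rewrite iter_obindS fi; exists m.
    by exists m.+1; rewrite iter_obindS fi.
  rewrite big1 ?subr0 => [|j _]; last by rewrite mulr0.
  rewrite /c asboolT //; exists 1%N; exact: fi.
Qed.

(* Each [u] makes a choice [c] of weight [p u c], which sends it to [h u c]. *)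
Lemma matrix_forest (K : fieldType) (T I : finType) (h : T -> I -> option T)
    (p : T -> I -> K) :
  \sum_(g : {ffun T -> I} | `[< mortal (fun u => h u (g u)) >])
     \prod_u p u (g u)
  = \det (\matrix_(i < #|T|, j < #|T|) \sum_c p (enum_val i) c *
      ((enum_val i == enum_val j)%:R
       - (h (enum_val i) c == Some (enum_val j))%:R)).
Proof.
rewrite /determinant.
pose M u c v : K := p u c * ((u == v)%:R - (h u c == Some v)%:R).
transitivity (\sum_(s : 'S_#|T|) (-1) ^+ s *
    \prod_u \sum_c M u c (enum_val (s (enum_rank u)))); last first.
  apply: eq_bigr => s _; rewrite -big_enum_valT; congr (_ * _).
  by apply: eq_bigr => i _; rewrite mxE enum_valK.
(* Multilinearity in the rows: each choice function [g] contributes its weight times the determinant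
   of [det_mortal] for the partial map [u -> h u (g u)]. *)
under [RHS]eq_bigr => s _ do rewrite bigA_distr_bigA big_distrr /=.
rewrite exchange_big big_mkcond /=; apply: eq_bigr => g _.
under [RHS]eq_bigr => s _ do rewrite big_split /= mulrCA.
rewrite -big_distrr /=; have := det_mortal K (fun u => h u (g u)).
rewrite /determinant => H.
rewrite [X in _ = _ * X](_ : _ = `[< mortal (fun u => h u (g u)) >]%:R); last first.
  rewrite -H; apply: eq_bigr => s _; congr (_ * _); rewrite -big_enum_valT.
  by apply: eq_bigr => i _; rewrite mxE enum_valK.
by case: asbool; rewrite ?mulr1 ?mulr0.
Qed.

(** * Transitions between cyclically ordered layers *)

Lemma val_iter_ordS (k : nat) (j : 'I_k) m : iter m (@ordS k) j = ((j + m) %% k)%N :> nat.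
Proof.
elim: m => [|m IH] /=; first by rewrite addn0 modn_small.
by rewrite IH -addn1 modnDml addn1 addnS.
Qed.

Lemma iter_ordS_connect (k : nat) (i j : 'I_k) : exists m, iter m (@ordS k) i = j.
Proof.
(* [k - i] steps lead from [i] round to index 0, and [j] more to [j]. *)
exists (j + (k - i))%N; apply/val_inj; rewrite /= val_iter_ordS.
by rewrite addnCA subnKC ?(ltnW (ltn_ord i)) // modnDr modn_small.
Qed.

(* Each [j] moves on with weight [a j] and dies with weight [1 - a j]; the only
   choice that is not mortal is the one where all move on. *)
Lemma det_sub1_cyclic (K : fieldType) (k : nat) (hk : (0 < k)%N) (a : 'I_k -> K) :
  \det (\matrix_(i < #|'I_k|, j < #|'I_k|)
     ((enum_val i == enum_val j)%:R
      - a (enum_val i) * (ordS (enum_val i) == enum_val j)%:R))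
  = 1 - \prod_j a j.
Proof.
pose h (j : 'I_k) (b : bool) := if b then Some (ordS j) else None.
pose p (j : 'I_k) (b : bool) := if b then a j else 1 - a j.
have := matrix_forest h p.
set M1 := \matrix_(i, j) _; set M2 := \matrix_(i, j) _.
have -> : M1 = M2.
  apply/matrixP => i j; rewrite !mxE big_bool /p /h /= (inj_eq Some_inj) subr0.
  by rewrite mulrBr mulrBl mul1r addrC addrA addrNK addrC.
move=> <-.
(* The two weights at each index add up to 1, hence so do the weights of all choices. *)
have tot : \sum_(g : {ffun 'I_k -> bool}) \prod_u p u (g u) = 1.
  rewrite -(bigA_distr_bigA (fun u b => p u b)) big1 // => u _.
  by rewrite big_bool /p /= addrCA subrr addr0.
have allT : \prod_u p u ([ffun=> true] u) = \prod_j a j.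
  by apply: eq_bigr => u _; rewrite ffunE.
transitivity (\sum_(g : {ffun _ -> _}) \prod_u p u (g u) - \prod_j a j);
  last by rewrite tot.
rewrite [in RHS](bigD1 [ffun=> true]) //= allT addrAC subrr add0r.
apply: eq_bigl => g; apply/asboolP/idP => [gm|].
  apply/eqP => gT; have [m] := gm (Ordinal hk).
  have {}gT u : g u by rewrite gT ffunE.
  elim: m (Ordinal hk) => // m IH u.
  by rewrite iter_obindS gT; apply: IH.
have [/existsP[j gj] _ u|/existsPn gT /eqP[]] := boolP [exists j, ~~ g j].
  have [m] := iter_ordS_connect u j.
  elim: m u => [|m IH] u; first by move=> /= ->; exists 1%N; rewrite /= (negPf gj).
  rewrite iterSr => /IH[m' Hm'].
  case gu: (g u); last by exists 1%N; rewrite /= gu.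
  by exists m'.+1; rewrite iter_obindS gu.
by apply/ffunP => j; rewrite ffunE; apply/negPn/gT.
Qed.

Lemma sum_pred1l (K : pzSemiRingType) (T : finType) (F : T -> K) v :
  \sum_w (w == v)%:R * F w = F v.
Proof.
rewrite (bigD1 v) //= eqxx mul1r big1 ?addr0 // => w /negPf->.
by rewrite mul0r.
Qed.

(** Without the condition that orbits reach [C], the sum would be the product of the first two
    factors; the last factor is the determinant of [1 - P Q] that this condition brings in. *)
Lemma layered_forest (K : fieldType) (k : nat) (hk : (0 < k)%N) (V : finType)
    (lab : V -> 'I_k) (C : {set V}) (nx : V -> V) (x : V -> K)
    (E := fun j => \sum_(v | lab v == j) x v) :
  (forall j, E j != 0) ->
  \sum_(g : {ffun V -> V} |
      [&& [forall u, if u \in C then g u == nx u else lab (g u) == ordS (lab u)]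
        & `[< forall u, exists m, iter m g u \in C >]])
     \prod_u x (g u)
  = \prod_(u in C) x (nx u) * \prod_(u in ~: C) E (ordS (lab u))
    * (1 - \prod_j ((\sum_(v | (lab v == j) && (v \notin C)) x v) / E j)).
Proof.
move=> E0.
(* A walk ends on [C] or when about to enter it, so mortality means that every orbit of [g] meets
   [C]. The indicator in [p] discards the [g] that violate [nx] or the layers. *)
pose h u c := if (u \in C) || (c \in C) then None else Some c.
pose p u c : K := (if u \in C then c == nx u else lab c == ordS (lab u))%:R * x c.
transitivity (\sum_(g : {ffun V -> V} | `[< mortal (fun u => h u (g u)) >])
     \prod_u p u (g u)).
  have mE (g : {ffun V -> V}) :
      `[< mortal (fun u => h u (g u)) >] = `[< forall u, exists m, iter m g u \in C >].
    apply: asbool_equiv_eq; split=> H u; have [m] := H u.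
      elim: m u => // m IH u; rewrite iter_obindS /h.
      case: ifP => [/orP[uC _|gC _]|_ /IH[m']]; [by exists 0%N|by exists 1%N|].
      by exists m'.+1; rewrite iterSr.
    elim: m u => [|m IH] u; first by move=> /= uC; exists 1%N; rewrite /= /h uC.
    rewrite iterSr => /IH[m' Hm'].
    case e: ((u \in C) || (g u \in C)); first by exists 1%N; rewrite /= /h e.
    by exists m'.+1; rewrite iter_obindS /h e.
  rewrite big_mkcond [RHS]big_mkcond /=; apply: eq_bigr => g _; rewrite mE.
  case: asbool; rewrite ?andbF ?andbT //.
  case: ifP => [/forallP Hg|/negbT].
    by apply: eq_bigr => u _; rewrite /p; have := Hg u; case: ifP => _ ->; rewrite mul1r.
  rewrite negb_forall => /existsP[u gu].
  rewrite (bigD1 u) //= /p; case: ifP gu => _ /negPf->; by rewrite mul0r mul0r.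
rewrite matrix_forest.
pose D u := if u \in C then x (nx u) else E (ordS (lab u)).
have ED u : \sum_c p u c = D u.
  rewrite /p /D; case: ifP => _; first exact: sum_pred1l.
  by rewrite /E [RHS]big_mkcond; apply: eq_bigr => c _; case: eqP; rewrite ?mul1r ?mul0r.
(* [P] passes from a point off [C] to the next layer, and [Q] picks a point off [C] in a given layer
   with relative weight [x / E]. The transitions thus factor through the [k] layers. *)
pose P : 'M[K]_(#|V|, #|'I_k|) := \matrix_(i, j)
  ((enum_val i \notin C) && (ordS (lab (enum_val i)) == enum_val j))%:R.
pose Q : 'M[K]_(#|'I_k|, #|V|) := \matrix_(i, j)
  (((enum_val j \notin C) && (lab (enum_val j) == enum_val i))%:R
   * x (enum_val j) / E (enum_val i)).
transitivity (\det (diag_mx (\row_i D (enum_val i)) *m (1%:M - P *m Q))).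
  congr determinant; apply/matrixP => i j; rewrite mul_diag_mx !mxE.
  under eq_bigr do rewrite mulrBr.
  rewrite sumrB -big_distrl /= ED mulrBr -(inj_eq enum_val_inj); congr (_ - _).
  under [X in _ = _ * X]eq_bigr do rewrite !mxE.
  rewrite (big_enum_valT _ (fun l =>
    ((enum_val i \notin C) && (ordS (lab (enum_val i)) == l))%:R
    * (((enum_val j \notin C) && (lab (enum_val j) == l))%:R * x (enum_val j) / E l))).
  set u := enum_val i; set w := enum_val j; rewrite /h /p /D.
  case: (u \in C) => /=; first by rewrite !big1 ?mulr0 // => ? _; rewrite ?mulr0 ?mul0r.
  transitivity (x w * ((w \notin C) && (lab w == ordS (lab u)))%:R).
    rewrite (bigD1 w) //= big1 ?addr0 => [|c /negPf cw].
      rewrite -mulnb natrM; case: (w \in C) => /=; first by rewrite !(mulr0, mul0r).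
      by rewrite eqxx mulr1 mul1r mulrC.
    by case: ifP; rewrite ?(inj_eq Some_inj) ?cw mulr0.
  under [X in _ = _ * X]eq_bigr => l _ do rewrite eq_sym.
  by rewrite sum_pred1l [RHS]mulrC divfK // mulrC.
rewrite det_mulmx det_diag det_sub1_mulC; congr (_ * _).
  under eq_bigr do rewrite mxE.
  rewrite (big_enum_valT _ D) (bigID (mem C)) /=; congr (_ * _).
    by apply: eq_bigr => u uC; rewrite /D uC.
  by apply: eq_big => [u|u /negPf uC]; rewrite ?inE // /D uC.
(* [Q P] leads only from a layer to the next one, weighted by the share of the former that lies off
   [C]. *)
rewrite -det_sub1_cyclic //; congr determinant; apply/matrixP => i j.
rewrite !mxE (inj_eq enum_val_inj); congr (_ - _).
under eq_bigr do rewrite !mxE.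
set l := enum_val i; set l' := enum_val j.
rewrite (big_enum_valT _ (fun v =>
  ((v \notin C) && (lab v == l))%:R * x v / E l
  * ((v \notin C) && (ordS (lab v) == l'))%:R)).
rewrite [in RHS]big_mkcond /= mulrAC !big_distrl /=; apply: eq_bigr => v _.
rewrite andbC; case: eqP => [->|]; rewrite ?mul0r //=.
by case: (v \in C); rewrite ?mul0r //= mul1r mulrAC.
Qed.

(** * Sums over finite subsets *)

(** An [N]-subset is the image of exactly [N!] injections of ['I_N]. *)
Lemma sum_inj_ffun (R : pzRingType) (V : finType) (N : nat) (U : {set V})
    (F : {set V} -> R) :
  \sum_(f : {ffun 'I_N -> V} | injectiveb f && [forall a, f a \in U])
     F [set f a | a : 'I_N]
  = N`!%:R * \sum_(S : {set V} | (S \subset U) && (#|S| == N)) F S.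
Proof.
rewrite (partition_big (fun f : {ffun _ -> _} => [set f a | a : 'I_N])
          (fun S => (S \subset U) && (#|S| == N))) => [|f /andP[/injectiveP fI /forallP fU]].
  rewrite big_distrr /=; apply: eq_bigr => S /andP[SU /eqP SN].
  transitivity (\sum_(f in
      [set f in ffun_on (mem S) | injectiveb (f : {ffun 'I_N -> V})]) F S).
    apply: eq_big => [f|f /andP[_ /eqP->]//].
    rewrite inE; apply/idP/idP => [/andP[/andP[-> _] /eqP <-]|/andP[/ffun_onP fS fI]].
      by rewrite andbT; apply/ffun_onP => a; apply/imsetP; exists a.
    rewrite fI /=; apply/andP; split; first by apply/forallP => a; apply: (subsetP SU).
    rewrite eqEcard card_imset ?card_ord ?SN ?leqnn ?andbT; last exact/injectiveP.
    by apply/subsetP => _ /imsetP[a _ ->]; apply: fS.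
  by rewrite sumr_const card_inj_ffuns_on card_ord SN ffactnn mulr_natl.
rewrite card_imset // card_ord eqxx andbT.
by apply/subsetP => _ /imsetP[a _ ->].
Qed.

(* Both sides sum [x^(S + v)] over pairs [(S, v)] with [v] outside [S]. *)
Lemma sum_remove_one (R : comPzRingType) (V : finType) (N : nat) (U : {set V})
    (x : V -> R) :
  \sum_(S : {set V} | (S \subset U) && (#|S| == N))
     (\prod_(v in S) x v) * (\sum_(v in U :\: S) x v)
  = N.+1%:R * \sum_(S : {set V} | (S \subset U) && (#|S| == N.+1)) \prod_(v in S) x v.
Proof.
under eq_bigr do rewrite big_distrr /=.
transitivity (\sum_(S : {set V} | (S \subset U) && (#|S| == N.+1))
   \sum_(v in S) \prod_(w in S) x w); last first.
  rewrite big_distrr; apply: eq_bigr => S /andP[_ /eqP SN] /=.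
  by rewrite sumr_const SN mulr_natl.
rewrite !pair_big_dep /=.
rewrite [RHS](reindex_onto (fun q : {set V} * V => (q.2 |: q.1, q.2))
                           (fun q => (q.1 :\ q.2, q.2))) /=; last first.
  by move=> [S v] /= /andP[_ vS]; rewrite setD1K.
apply: eq_big => [[S v]|[S v]] /=.
  rewrite setU11 andbT subUset sub1set cardsU1 in_setD xpair_eqE eqxx andbT.
  case vS : (v \in S) => /=.
    rewrite andbF; apply/esym/negP => /andP[_ /eqP/setP/(_ v)].
    by rewrite !inE eqxx vS.
  rewrite setU1K ?vS // eqxx andbT add1n eqSS.
  by case: (v \in U); rewrite ?andbT ?andbF.
case/andP => _; rewrite inE => /andP[vS _].
by rewrite big_setU1 //= mulrC.
Qed.

(** * Labelled cycles *)

Section CycleLabellings.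

Variables (k N : nat) (hk : (0 < k)%N) (hN : (0 < N)%N).
Variables (V : finType) (lab : V -> 'I_k).

Implicit Types (s : {ffun 'I_k -> {ffun 'I_N -> V}}) (G : V -> V).

Definition labelling s : bool :=
  [forall j, injectiveb (s j) && [forall a, lab (s j a) == j]].

(* The infinite walk around the cycle: label (j, a) has position j + a k. *)
Definition walk s m : V :=
  s (Ordinal (ltn_pmod m hk)) (Ordinal (ltn_pmod (m %/ k) hN)).

Definition cycle_support s : {set V} := [set s p.1 p.2 | p : 'I_k * 'I_N].

(** For a labelling, the label found by [pick] is unique; off the support [u] is a default value. *)
Definition cycle_succ s (u : V) : V :=
  if [pick p | s p.1 p.2 == u] is Some p then walk s (p.1 + p.2 * k).+1 else u.

Definition attracting_cycle G s : bool :=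
  [forall u in cycle_support s, G u == cycle_succ s u]
  && `[< forall u, exists m, iter m G u \in cycle_support s >].

Lemma walkE s (j : 'I_k) (a : 'I_N) : walk s (j + a * k) = s j a.
Proof.
rewrite /walk; congr (s _ _); apply/val_inj => /=.
  by rewrite addnC modnMDl modn_small.
by rewrite addnC divnMDl // divn_small // addn0 modn_small.
Qed.

Lemma walk_period s m q : walk s (m + q * (N * k)) = walk s m.
Proof.
rewrite /walk; congr (s _ _); apply/val_inj; rewrite /= mulnA addnC.
  by rewrite modnMDl.
by rewrite divnMDl // modnMDl.
Qed.

(** Mixed-radix expansion of a position: layer, round, number of full turns. *)
Lemma walk_indexE m :
  (m %% k + m %/ k %% N * k + m %/ k %/ N * (N * k))%N = m.
Proof.
rewrite mulnA -addnA -mulnDl [(_ + _ * N)%N]addnC -divn_eq addnC.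
by rewrite -divn_eq.
Qed.

Lemma walk_support s m : walk s m \in cycle_support s.
Proof.
by apply/imsetP; exists (Ordinal (ltn_pmod m hk), Ordinal (ltn_pmod (m %/ k) hN)).
Qed.

Lemma supportP s u : reflect (exists m, u = walk s m) (u \in cycle_support s).
Proof.
apply: (iffP idP) => [/imsetP[[j a] _ ->]|[m ->]]; last exact: walk_support.
by exists (j + a * k)%N; rewrite walkE.
Qed.

Lemma labelling_lab s j a : labelling s -> lab (s j a) = j.
Proof. by move/forallP/(_ j)/andP => [_ /forallP/(_ a)/eqP]. Qed.

Lemma labelling_inj s : labelling s ->
  injective (fun p : 'I_k * 'I_N => s p.1 p.2).
Proof.
move=> sL [j a] [j' a'] /= e.
have jj : j = j' by rewrite -(labelling_lab j a sL) e labelling_lab.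
subst j'; have /forallP/(_ j)/andP[/injectiveP sI _] := sL.
by rewrite (sI _ _ e).
Qed.

Lemma succ_walk s m : labelling s -> cycle_succ s (walk s m) = walk s m.+1.
Proof.
move=> sL; rewrite /cycle_succ; case: pickP => [[j a] /= /eqP e|]; last first.
  move/(_ (Ordinal (ltn_pmod m hk), Ordinal (ltn_pmod (m %/ k) hN))).
  by rewrite eqxx.
have [-> ->] : j = Ordinal (ltn_pmod m hk) /\
    a = Ordinal (ltn_pmod (m %/ k) hN).
  by have [] := labelling_inj sL (e : s (j, a).1 (j, a).2 = s (_, _).1 (_, _).2).
rewrite -(walk_period _ _ (m %/ k %/ N)) addSn; congr (walk s _.+1).
exact: walk_indexE.
Qed.

Lemma succ_support s u : labelling s ->
  u \in cycle_support s -> cycle_succ s u \in cycle_support s.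
Proof. by move=> sL /supportP[m ->]; rewrite succ_walk ?walk_support. Qed.

(** After one step, [N * k - 1] further steps close the turn, which gives a left inverse. *)
Lemma succ_inj s : labelling s -> {in cycle_support s &, injective (cycle_succ s)}.
Proof.
move=> sL u v /supportP[m ->] /supportP[n ->]; rewrite !succ_walk // => e.
have it i j : iter j (cycle_succ s) (walk s i) = walk s (j + i).
  by elim: j => //= j ->; rewrite succ_walk.
have ret i : iter (N * k).-1 (cycle_succ s) (walk s i.+1) = walk s i.
  by rewrite it -addSnnS prednK ?muln_gt0 ?hN // addnC -[X in (_ + X)%N]mul1n walk_period.
by rewrite -(ret m) e ret.
Qed.

Lemma lab_succ s u : labelling s ->
  u \in cycle_support s -> lab (cycle_succ s u) = ordS (lab u).
Proof.
move=> sL /supportP[m ->]; rewrite succ_walk // !labelling_lab //.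
by apply/val_inj; rewrite /= -addn1 -modnDml addn1.
Qed.

Lemma prod_support (R : comPzRingType) (x : V -> R) s : labelling s ->
  \prod_(u in cycle_support s) x u = \prod_j \prod_a x (s j a).
Proof.
move=> sL; rewrite big_imset /=; last by move=> p q _ _; apply: labelling_inj.
by rewrite pair_big.
Qed.

(** The successor is an injective self-map of the finite support, hence permutes it. *)
Lemma prod_succ (R : comPzRingType) (x : V -> R) s : labelling s ->
  \prod_(u in cycle_support s) x (cycle_succ s u) = \prod_(u in cycle_support s) x u.
Proof.
move=> sL; have {2}<- : [set cycle_succ s u | u in cycle_support s] = cycle_support s.
  apply/eqP; rewrite eqEcard card_in_imset ?leqnn ?andbT; last exact: succ_inj.
  by apply/subsetP => _ /imsetP[u us ->]; apply: succ_support.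
by rewrite [RHS]big_imset //=; apply: succ_inj.
Qed.

(** The form of [eventually_cyclic] for a self-map of a plain finite type with a layer function,
    which avoids dependent types. *)
Definition eventually_cycles (i1 : 'I_k) G : Prop :=
  exists A : {set V},
    [/\ exists M : nat, forall m : nat, (M <= m)%N ->
          [set iter m (iter k G) v | v in [set v | lab v == i1]] = A,
        A \subset [set v | lab v == i1],
        #|A| = N
      & acts_as_cycle (iter k G) A].

Let o : 'I_k := Ordinal hk.

(** For [v] a periodic point of [G] in the first layer, this will be the one attracting labelling
    that starts at [v]. *)
Definition orbit_labelling G v : {ffun 'I_k -> {ffun 'I_N -> V}} :=
  [ffun j : 'I_k => [ffun a : 'I_N => iter (j + a * k) G v]].

(** * Counting the labellings that a given map follows *)

Section Attracted.
Variables (G : V -> V) (GL : forall u, lab (G u) = ordS (lab u)).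

Lemma lab_iter m u : lab (iter m G u) = iter m (@ordS k) (lab u).
Proof. by elim: m => //= m <-. Qed.

Lemma lab_iter_mul m u : lab (iter m (iter k G) u) = lab u.
Proof.
rewrite -iterM lab_iter; apply/val_inj; rewrite /= val_iter_ordS.
by rewrite addnC modnMDl modn_small.
Qed.

Lemma iter_walk s m n : labelling s -> attracting_cycle G s ->
  iter m G (walk s n) = walk s (m + n).
Proof.
move=> sL /andP[/forall_inP sG _]; elim: m => //= m ->.
by have /eqP-> := sG _ (walk_support s (m + n)); rewrite succ_walk.
Qed.

Lemma attracting_eventually_cycles s : labelling s -> attracting_cycle G s ->
  eventually_cycles o G.
Proof.
move=> sL sG; pose A := [set s o a | a : 'I_N].
have rw m n : iter m (iter k G) (walk s n) = walk s (m * k + n).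
  by rewrite -iterM iter_walk.
have inA m : walk s (m * k) \in A.
  apply/imsetP; exists (Ordinal (ltn_pmod m hN)) => //; rewrite /walk.
  by congr (s _ _); apply/val_inj; rewrite /= ?modnMl ?mulnK.
have sI : injective (s o) by move/forallP/(_ o)/andP: sL => [/injectiveP].
have AN : #|A| = N by rewrite card_imset // card_ord.
exists A; split=> //.
- have [/forall_inP sE /asboolP reach] := andP sG.
  have [t tP] := fin_all_exists reach.
  (* Beyond the largest hitting time all orbits are on the cycle. *)
  exists (\max_u t u) => m tm; apply/eqP.
  rewrite eqEsubset; apply/andP; split; apply/subsetP => w /imsetP.
    case=> v; rewrite inE => /eqP vo ->{w}.
    have /supportP[n nE] := tP v.
    have tvm : (t v <= m * k)%N.
      apply: leq_trans (leq_pmulr m hk); apply: leq_trans tm; exact: leq_bigmax.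
    have : lab (iter m (iter k G) v) = o by rewrite lab_iter_mul.
    rewrite -iterM -(subnK tvm) iterD nE iter_walk // labelling_lab //.
    (* Being in layer 0, the point has a position divisible by [k]. *)
    move=> /(congr1 val) /= /eqP/dvdnP[q ->]; exact: inA.
  (* The witness lies [m] rounds back: adding [m * k] to its position gives [a * k] plus [m] full
     turns. *)
  case=> a _ ->; apply/imsetP; exists (walk s (a * k + m * (N - 1) * k)).
    rewrite inE labelling_lab //; apply/eqP/val_inj => /=.
    by rewrite -mulnDl modnMl.
  rewrite rw addnCA -mulnDl -{1}[m]muln1 -mulnDr subnKC // -mulnA walk_period.
  by rewrite -walkE.
- by apply/subsetP => _ /imsetP[a _ ->]; rewrite inE labelling_lab.
- exists (traject (iter k G) (walk s 0) N).
  have tE : traject (iter k G) (walk s 0) N = [seq s o a | a <- enum 'I_N].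
    apply: (@eq_from_nth _ (walk s 0)); first by rewrite size_traject size_map size_enum_ord.
    rewrite size_traject => i iN; rewrite nth_traject // rw addn0.
    rewrite (nth_map (Ordinal hN)) ?size_enum_ord //.
    rewrite -(walkE s o) /= add0n; congr (walk s (_ * k)).
    by rewrite nth_enum_ord.
  split; last by apply/setP => w; rewrite !inE tE;
    apply/imsetP/mapP => -[a _ ->]; exists a; rewrite ?mem_enum.
  rewrite /ucycle; apply/andP; split.
    have rN : iter N (iter k G) (walk s 0) = walk s 0.
      by rewrite rw addnC -[(N * k)%N]mul1n walk_period.
    case: (N) hN rN => // n _ rN; rewrite trajectS /= -[X in rcons _ X]rN iterSr.
    by rewrite -trajectSr; exact: fpath_traject.
  by rewrite tE map_inj_uniq ?enum_uniq.
Qed.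

(** An attracting labelling is determined by its starting point, which can be any of the [N] points
    of the stable set [A]; [orbit_labelling] is the bijection from [A]. *)
Lemma card_attracting_labellings :
  #|[pred s | labelling s && attracting_cycle G s]|
  = if `[< eventually_cycles o G >] then N else 0.
Proof.
case: asboolP => [[A [[M AM] Ao AN [t [/andP[tc tu] At]]]]|nG]; last first.
  apply: eq_card0 => s; rewrite inE; apply/negP => /andP[sL sG].
  exact: nG (attracting_eventually_cycles sL sG).
set R := iter k G in AM tc.
have memA v : (v \in A) = (v \in t) by rewrite At inE.
have tN : size t = N by rewrite -AN -(card_uniqP tu); apply: eq_card => v; rewrite memA.
have ord v : v \in A -> order R v = N by rewrite memA => vt; rewrite (order_cycle tc).
have RN v : v \in A -> iter N R v = v.
  by move=> vA; rewrite -(ord v vA) (iter_order_cycle tc) -?memA.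
have RI v a b : v \in A -> (a < N)%N -> (b < N)%N -> iter a R v = iter b R v -> a = b.
  move=> vA aN bN e; have := orbit_uniq R v; rewrite /orbit ord // => u.
  apply/eqP; rewrite -(nth_uniq v _ _ u) ?size_traject // !nth_traject //.
  exact/eqP.
have labA v : v \in A -> lab v = o by move/(subsetP Ao); rewrite inE => /eqP.
have olE v (j : 'I_k) (a : 'I_N) :
    orbit_labelling G v j a = iter j G (iter a R v).
  by rewrite !ffunE iterD iterM.
have walk_ol v m : v \in A -> walk (orbit_labelling G v) m = iter m G v.
  move=> vA; rewrite /walk olE /= -iterM -iterD.
  rewrite -[in RHS](walk_indexE m) [in RHS]iterD [iter (_ * (N * k)) _ _]iterM.
  by rewrite [iter (m %/ k %/ N) _ _]iter_fix // iterM RN.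
have ol_lab v : v \in A -> labelling (orbit_labelling G v).
  move=> vA; apply/forallP => j; apply/andP; split; last first.
    apply/forallP => a; rewrite olE lab_iter /R lab_iter_mul labA //.
    by apply/eqP/val_inj; rewrite /= val_iter_ordS add0n modn_small.
  (* The added steps complete [j] to [N * k], that is to [N] rounds, which fix the points of [A]. *)
  apply/injectiveP => a b; rewrite !olE => /(congr1 (iter (N.-1 * k + (k - j)) G)).
  rewrite -!iterD -!addnA subnK ?(ltnW (ltn_ord j)) // -mulSnr prednK //.
  rewrite !iterM -/R => e; apply/val_inj/(RI v _ _ vA (ltn_ord a) (ltn_ord b)).
  by move: e; rewrite -!iterD ![(N + _)%N]addnC !iterD RN.
have ol_attr v : v \in A -> attracting_cycle G (orbit_labelling G v).
  move=> vA; apply/andP; split.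
    apply/forall_inP => _ /supportP[m ->]; rewrite succ_walk ?ol_lab //.
    by rewrite !walk_ol.
  apply/asboolP => u.
  (* [j] steps bring [u] to the first layer and [M] rounds then bring it into [A], which is the
     orbit of [v] under [R]. *)
  have [j uj] := iter_ordS_connect (lab u) o.
  exists (M * k + j)%N; rewrite iterD iterM -/R.
  have wA : iter M R (iter j G u) \in A.
    by rewrite -(AM M) //; apply: imset_f; rewrite inE lab_iter uj.
  have : fconnect R v (iter M R (iter j G u)).
    by rewrite (fconnect_cycle tc) -memA.
  move/iter_findex => <-; rewrite -iterM -walk_ol //.
  exact: walk_support.
rewrite -[RHS]AN -(card_in_imset (f := orbit_labelling G) (D := mem A)).
  apply: eq_card => s; rewrite !inE; apply/andP/imsetP; last first.
    by case=> v vA ->; rewrite ol_lab ?ol_attr.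
  case=> sL sG.
  have sA : walk s 0 \in A.
    (* The start lies in the stable image: [M] rounds from this witness end after [M] full turns. *)
    rewrite -(AM M) //; apply/imsetP; exists (walk s (M * (N - 1) * k)).
      by rewrite inE labelling_lab //; apply/eqP/val_inj; rewrite /= modnMl.
    rewrite -iterM iter_walk // -mulnDl -{1}[M]muln1 -mulnDr subnKC // -mulnA.
    by rewrite -[(M * _)%N]add0n walk_period.
  exists (walk s 0) => //; apply/ffunP => j; apply/ffunP => a.
  by rewrite olE /R -iterM -iterD iter_walk // addn0 walkE.
move=> v w vA wA /(congr1 (fun s => walk s 0)).
by rewrite !walk_ol.
Qed.

End Attracted.
End CycleLabellings.

(** * The weighted count *)

Section WeightedCount.

Variables (K : fieldType) (k N : nat) (hk : (0 < k)%N) (hN : (0 < N)%N).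
Variables (V : finType) (lab : V -> 'I_k) (x : V -> K).

Let L (j : 'I_k) : {set V} := [set v | lab v == j].
Let E (j : 'I_k) := \sum_(v in L j) x v.
Let e (m : nat) (U : {set V}) :=
  \sum_(S : {set V} | (S \subset U) && (#|S| == m)) \prod_(v in S) x v.
Let o : 'I_k := Ordinal hk.

Hypothesis E0 : forall j, E j != 0.

Definition layered (g : V -> V) : bool := [forall u, lab (g u) == ordS (lab u)].

(** This is [layered_forest] with [C] the support of [s]. The [n_(i-1) - N] points off [C] in layer
    [i - 1] contribute [E i] each; one [E i] per layer is set aside to clear the denominators, hence
    the exponent with [N + 1]. *)
Lemma sum_layered_attracted (s : {ffun 'I_k -> {ffun 'I_N -> V}}) :
  labelling lab s ->
  \sum_(g : {ffun V -> V} | layered g && attracting_cycle hk hN g s) \prod_u x (g u)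
  = (\prod_i E i ^ (#|L (ord_pred i)|%:Z - N.+1%:Z))
    * (\prod_j \prod_a x (s j a)
       * (\prod_j E j - \prod_j \sum_(v in L j :\: [set s j a | a : 'I_N]) x v)).
Proof.
move=> sL; set C := cycle_support s.
have CE u : (u \in C) = (u \in [set s (lab u) a | a : 'I_N]).
  apply/imsetP/imsetP => [[[j a] _ ->]|[a _ ua]] /=.
    by exists a; rewrite ?(labelling_lab j a sL).
  by exists (lab u, a).
have LC j : L j :\: C = L j :\: [set s j a | a : 'I_N].
  by apply/setP => u; rewrite !inE CE; case: eqP => [->|]; rewrite ?andbF.
have ELE j : E j = \sum_(v | lab v == j) x v by apply: eq_bigl => v; rewrite inE.
have E0' j : \sum_(v | lab v == j) x v != 0 by rewrite -ELE.
have := layered_forest hk C (cycle_succ hk hN s) E0'.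
rewrite (prod_succ hk hN x sL) (prod_support x sL) => H.
transitivity (\sum_(g : {ffun V -> V} |
      [&& [forall u, if u \in C then g u == cycle_succ hk hN s u
                     else lab (g u) == ordS (lab u)]
        & `[< forall u, exists m, iter m g u \in C >]])
     \prod_u x (g u)).
  apply: eq_bigl => g; rewrite /attracting_cycle andbA; congr (_ && _).
  apply/andP/forallP => [[/forallP gl /forall_inP gs] u|gs].
    by case: ifP => // uC; apply: gs.
  split; last by apply/forall_inP => u uC; have := gs u; rewrite uC.
  apply/forallP => u; have := gs u; case: ifP => // uC /eqP->.
  by rewrite lab_succ.
rewrite {}H.
have -> : \prod_(j < k) ((\sum_(v | (lab v == j) && (v \notin C)) x v)
                            / (\sum_(v | lab v == j) x v))
   = \prod_j (\sum_(v in L j :\: [set s j a | a : 'I_N]) x v) / \prod_j E j.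
  rewrite -prodf_div; apply: eq_bigr => j _; rewrite ELE; congr (_ / _).
  by apply: eq_bigl => v; rewrite -LC !inE andbC.
have PE0 : \prod_j E j != 0 by apply/prodf_neq0 => j _.
have sLN j : #|[set s j a | a : 'I_N]| = N.
  rewrite card_imset ?card_ord //; apply/injectiveP.
  by have /forallP/(_ j)/andP[] := sL.
have sLs j : [set s j a | a : 'I_N] \subset L j.
  by apply/subsetP => _ /imsetP[a _ ->]; rewrite inE (labelling_lab j a sL).
have -> : \prod_(u in ~: C) (\sum_(v | lab v == ordS (lab u)) x v)
    = (\prod_i E i ^ (#|L (ord_pred i)|%:Z - N.+1%:Z)) * \prod_j E j.
  rewrite -big_split (partition_big lab predT) //=.
  rewrite [LHS](reindex (@ord_pred k)) /=; last first.
    by exists (@ordS k) => i _; rewrite ?ordSK ?ord_predK.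
  apply: eq_bigr => i _.
  rewrite -[E i in X in _ = _ * X]expr1z -expfzDr //.
  (* The labelling puts [N] points into every layer, so this difference is a natural number. *)
  have -> : #|L (ord_pred i)|%:Z - N.+1%:Z + 1 = (#|L (ord_pred i)| - N)%N.
    rewrite -subzn ?subrK; last by rewrite -(sLN (ord_pred i)) subset_leq_card.
    by rewrite -addn1 PoszD opprD addrA subrK.
  rewrite -exprnP -{1}(sLN (ord_pred i)) -cardsDS // -LC.
  rewrite (eq_bigr (fun=> E i)) => [|u /andP[_ /eqP ->]]; last by rewrite ord_predK -ELE.
  rewrite prodr_const; congr (_ ^+ _); apply: eq_card => u.
  by rewrite [LHS]inE /= !inE.
rewrite -[X in X - _](divff PE0) -mulrBl.
by rewrite -!mulrA [X in _ * (_ * X)]mulrCA divff // mulr1 mulrCA.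
Qed.

(** A labelling is an independent choice of an injection into each layer. *)
Lemma sum_labelling (F : 'I_k -> {set V} -> K) :
  \sum_(s : {ffun 'I_k -> {ffun 'I_N -> V}} | labelling lab s)
    \prod_j F j [set s j a | a : 'I_N]
  = \prod_j (N`!%:R * \sum_(S : {set V} | (S \subset L j) && (#|S| == N)) F j S).
Proof.
under [RHS]eq_bigr do rewrite -sum_inj_ffun.
rewrite bigA_distr_big_dep; apply: eq_bigl => s.
apply: eq_forallb => j; rewrite [RHS]inE; congr (_ && _).
by apply: eq_forallb => a; rewrite inE.
Qed.

Lemma elem_sum1 (U : {set V}) : e 1 U = \sum_(v in U) x v.
Proof.
(* For [N = 0] the only set to remove is empty. *)
rewrite /e; have := sum_remove_one 0 U x; rewrite mul1r => <-.
rewrite (big_pred1 set0) ?big_set0 ?setD0 ?mul1r // => S.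
by rewrite /= cards_eq0 andbC; case: eqP => // ->; rewrite sub0set.
Qed.

Lemma weighted_count :
  N%:R * \sum_(g : {ffun V -> V} | layered g && `[< eventually_cycles N lab o g >])
            \prod_u x (g u)
  = ((N`! ^ k)%N%:R) *
    (\prod_i E i ^ (#|L (ord_pred i)|%:Z - N.+1%:Z))
    * (\prod_j (e N (L j) * e 1 (L j)) - (N.+1 ^ k)%N%:R * \prod_j e N.+1 (L j)).
Proof.
(* Double counting of pairs of a map and an attracting labelling: each eventually cyclic map occurs
   [N] times, any other never. *)
transitivity (\sum_(s : {ffun 'I_k -> {ffun 'I_N -> V}} | labelling lab s)
   \sum_(g : {ffun V -> V} | layered g && attracting_cycle hk hN g s) \prod_u x (g u)).
  rewrite (exchange_big_dep (fun g : {ffun V -> V} => layered g)) /=;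
    last by move=> s g _ /andP[].
  rewrite big_distrr /= [LHS]big_mkcondr /=; apply: eq_bigr => g lg.
  have gl u : lab (g u) = ordS (lab u) by apply/eqP/(forallP lg).
  have := card_attracting_labellings hk hN gl; rewrite -/o.
  rewrite sumr_const.
  rewrite (eq_card (B := [pred s | labelling lab s && attracting_cycle hk hN g s])).
    by move=> ->; case: asbool; rewrite ?mulr0n ?mulr0 // mulr_natl.
  by move=> s; rewrite [LHS]inE /= inE lg.
have prodE s j : labelling lab s ->
    \prod_(v in [set s j a | a : 'I_N]) x v = \prod_a x (s j a).
  by move=> /forallP/(_ j)/andP[/injectiveP sI _]; rewrite big_imset //= => a b _ _ /sI.
rewrite (eq_bigr _ (fun s sL => sum_layered_attracted sL)) -big_distrr /=.
rewrite [in RHS]mulrAC [in RHS]mulrC; congr (_ * _).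
(* The product of the [E j] leads to the [e_N e_1] term; in the other term [sum_remove_one] gives a
   factor [N + 1] per layer. *)
under eq_bigr do rewrite mulrBr.
rewrite sumrB mulrBr; congr (_ - _).
  rewrite -big_distrl /= big_split /= mulrA (eq_bigr _ (fun j _ => elem_sum1 (L j))).
  congr (_ * _).
  transitivity (\sum_(s : {ffun 'I_k -> {ffun 'I_N -> V}} | labelling lab s)
      \prod_j \prod_(v in [set s j a | a : 'I_N]) x v).
    by apply: eq_bigr => s sL; apply: eq_bigr => j _; rewrite prodE.
  rewrite (sum_labelling (fun _ S => \prod_(v in S) x v)) big_split /=.
  by rewrite prodr_const card_ord natrX.
transitivity (\sum_(s : {ffun 'I_k -> {ffun 'I_N -> V}} | labelling lab s)
    \prod_j (\prod_(v in [set s j a | a : 'I_N]) x v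
              * \sum_(v in L j :\: [set s j a | a : 'I_N]) x v)).
  apply: eq_bigr => s sL; rewrite big_split /=; congr (_ * _).
  by apply: eq_bigr => j _; rewrite prodE.
rewrite (sum_labelling (fun j S => \prod_(v in S) x v * \sum_(v in L j :\: S) x v)).
under eq_bigr do rewrite sum_remove_one.
by rewrite !big_split /= !prodr_const card_ord !natrX.
Qed.

End WeightedCount.

(** * Function tuples as layered self-maps of the disjoint union *)

Section FunTuples.

Variables (k : nat) (X : 'I_k -> finType).

Lemma card_layer j : #|layer X j| = #|X j|.
Proof.
rewrite -!sum1_card; transitivity (\sum_(i | i == j) \sum_(v in X i) 1)%N.
  by rewrite sig_big_dep; apply: eq_bigl => v; rewrite inE andbT.
by rewrite big_pred1_eq.
Qed.

Lemma weightE (f : fun_tuple X) : weight f = \prod_(v : vertex X) xvar (step f v).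
Proof. by rewrite /weight sig_big_dep. Qed.

(** [step] identifies tuples with the self-maps that send each layer to the next. *)
Lemma sum_fun_tuple (R : nmodType) (F : (vertex X -> vertex X) -> R) :
  (forall g h, g =1 h -> F g = F h) ->
  \sum_(f : fun_tuple X) F (step f)
  = \sum_(g : {ffun vertex X -> vertex X} | layered (fun v => tag v) g) F g.
Proof.
move=> Fext; pose phi (f : fun_tuple X) : {ffun vertex X -> vertex X} := [ffun v => step f v].
have phiI : injective phi.
  move=> f f' /ffunP e; apply/ffunP => i; apply/ffunP => v.
  have := e (Tagged X v); rewrite !ffunE => /eqP; rewrite -tag_eqE /tag_eq /= eqxx /=.
  by rewrite tagged_asE; move/eqP.
transitivity (\sum_(g in [set phi f | f : fun_tuple X]) F g).
  rewrite big_imset /=; last by move=> f f' _ _ /phiI.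
  by apply: eq_bigr => f _; apply: Fext => v; rewrite ffunE.
apply: eq_bigl => g; apply/imsetP/forallP => [[f _ ->] v|gl]; first by rewrite ffunE.
(* Surjectivity: the image of a point of layer [i] has tag [ordS i], so its component can be chosen
   in [X (ordS i)]. *)
have ex (i : 'I_k) (v : X i) : exists w : X (ordS i), Tagged X w == g (Tagged X v).
  have := gl (Tagged X v); case: (g _) => i' w /= /eqP e.
  by move: w; rewrite e => w; exists w.
exists [ffun i => [ffun v => xchoose (ex i v)]] => //.
apply/ffunP => -[i v]; rewrite ffunE /step /= !ffunE; apply/esym/eqP.
exact: xchooseP (ex i v).
Qed.

(** The variable of any point [w] of the layer has coefficient 1 in the sum. *)
Lemma xvar_sum_neq0 j : (0 < #|X j|)%N ->
  \sum_(v in layer X j) (xvar v)%:F != 0 :> {fraction poly_ring X}.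
Proof.
case/card_gt0P => w _; rewrite -rmorph_sum tofrac_eq0; apply/eqP.
move/(congr1 (mcoeff (U_(enum_rank (Tagged X w)))%MM)).
rewrite raddf_sum mcoeff0 (bigD1 (Tagged X w)) ?inE //= big1 => [|v /andP[_ vw]].
  by rewrite addr0 mcoeffXU eqxx => /eqP; rewrite oner_eq0.
by rewrite mcoeffXU (inj_eq enum_rank_inj) (negPf vw).
Qed.

Lemma natr_frac_neq0 N : (0 < N)%N -> N%:R != 0 :> {fraction poly_ring X}.
Proof.
move=> N0; rewrite -(rmorph_nat (@FracField.tofrac _)) tofrac_eq0.
rewrite -(rmorph_nat (@mpolyC #|vertex X| rat)) mpolyC_eq0.
by rewrite Num.Theory.pnatr_eq0 -lt0n.
Qed.

End FunTuples.

Theorem theorem1p3 (k N : nat) (hk : (0 < k)%N) (hN : (0 < N)%N)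
    (X : 'I_k -> finType) (hX : forall i : 'I_k, (0 < #|X i|)%N) :
  (P_ X (Ordinal hk) N)%:F =
    ((N`! ^ k)%N%:R / N%:R)
    * (\prod_(i < k)
         (elem_sym 1 (layer X i))%:F ^ (#|X (ord_pred i)|%:Z - N.+1%:Z))
    * (\prod_(j < k) ((elem_sym N (layer X j))%:F * (elem_sym 1 (layer X j))%:F)
       - (N.+1 ^ k)%N%:R * \prod_(j < k) (elem_sym N.+1 (layer X j))%:F)
  :> {fraction poly_ring X}.
Proof.
pose x (v : vertex X) : {fraction poly_ring X} := (xvar v)%:F.
have esE m (U : {set vertex X}) : (elem_sym m U)%:F =
    \sum_(S : {set vertex X} | (S \subset U) && (#|S| == m)) \prod_(v in S) x v.
  by rewrite rmorph_sum; apply: eq_bigr => S _; rewrite rmorph_prod.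
have N0 := natr_frac_neq0 X hN.
have := weighted_count hk hN (fun j => xvar_sum_neq0 (hX j)).
have -> : \sum_(g : {ffun vertex X -> vertex X} | layered (fun v => tag v) g &&
    `[< eventually_cycles N (fun v : vertex X => tag v) (Ordinal hk) g >])
     \prod_u (xvar (g u))%:F = (P_ X (Ordinal hk) N)%:F.
  pose F (g : vertex X -> vertex X) : {fraction poly_ring X} :=
    if `[< eventually_cycles N (fun v : vertex X => tag v) (Ordinal hk) g >]
    then \prod_u x (g u) else 0.
  rewrite big_mkcondr /= -(sum_fun_tuple (F := F)) => [|g h gh]; last first.
    by have -> : g = h by apply/funext.
  rewrite /P_ rmorph_sum [RHS]big_mkcond; apply: eq_bigr => f _.
  rewrite /F inE; case: asbool => //.
  by rewrite weightE rmorph_prod.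
move=> H; apply: (mulfI N0); rewrite H.
rewrite -!mulrA [RHS]mulrCA mulVKf //; congr (_ * (_ * _)).
  apply: eq_bigr => i _; rewrite esE elem_sum1 card_layer; congr (_ ^ _).
by congr (_ - _ * _); apply: eq_bigr => j _; rewrite !esE.
Qed.
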